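(* For every $\alpha>1$ the family $$\mathcal S_\alpha=\Bigl\{\frac{g_{v,j}}{\sqrt{b_{h(v),\alpha}}}: v\in\mathfrak X,\ j=1,\dots,q-1\Bigr\}$$ is an orthonormal basis for the horocyclic harmonic Bergman space $\mathcal B^2_\alpha$.
   Context: Tree. Let $q\ge 2$ be an integer and let $\mathfrak X$ be (the vertex set of) the $q$-homogeneous tree: the connected graph without cycles in which every vertex has exactly $q+1$ neighbours ($x\sim y$ means $x,y$ are neighbours); $d$ is the edge-counting distance, $\mathbb N=\{0,1,2,\dots\}$. An infinite chain is a sequence $(x_i)_{i\in\mathbb N}$ with $x_i\sim x_{i+1}$ and $x_i\ne x_{i+2}$; two infinite chains $(x_i),(y_j)$ are equivalent if for some $m\in\mathbb Z$ one has $x_i=y_{i+m}$ eventually; a boundary point is an equivalence class. Fix a boundary point $\omega$. For $x\in\mathfrak X$, $[x,\omega)$ is the infinite chain starting at $x$ in the class $\omega$ and $x\wedge y$ is the vertex $z$ with $[x,\omega)\cap[y,\omega)=[z,\omega)$. Vertices $x,y$ lie on the same horocycle if $d(x,x\wedge y)=d(y,x\wedge y)$. Fix a horocycle $H_0$ and, for $k\in\mathbb Z$, let $H_k=\{x: d(x,x\wedge y)=d(y,x\wedge y)+k \text{ for some } y\in H_0\}$; the $H_k$ partition $\mathfrak X$. The horocyclic index $h(x)$ is the integer with $x\in H_{h(x)}$. The predecessor $p(x)$ is the only neighbour of $x$ in $H_{h(x)-1}$; the set $S(x)$ of successors consists of the other $q$ neighbours, which lie in $H_{h(x)+1}$; $p^n$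 is the $n$-th iterate of $p$ ($p^0=\mathrm{id}$). $U_x=\{y:[x,\omega)\subseteq[y,\omega)\}$ is the sector generated by $x$ and $\dot U_x=U_x\setminus\{x\}$. Spaces. $f:\mathfrak X\to\mathbb C$ is harmonic if $f(x)=\frac1{q+1}\sum_{y\sim x}f(y)$ for all $x\in\mathfrak X$. For $\alpha>1$, $\sigma_\alpha(x)=q^{-\alpha h(x)}$, and $\mathcal B^2_\alpha$ is the space of harmonic $f:\mathfrak X\to\mathbb C$ with $\sum_{x}|f(x)|^2\sigma_\alpha(x)<\infty$, a Hilbert space with inner product $\langle f,g\rangle=\sum_x f(x)\overline{g(x)}\sigma_\alpha(x)$. The functions $g_{v,j}$. For $v\in\mathfrak X$ let $Z_v=\{\phi:S(v)\to\mathbb C:\ \sum_{x\in S(v)}\phi(x)=0\}$, a $(q-1)$-dimensional space with the inner product $\sum_{x\in S(v)}\phi(x)\overline{\psi(x)}$, and let $\{a_{v,j}: j=1,\dots,q-1\}$ be an (arbitrary) orthonormal basis of $Z_v$. Define $g_{v,j}:\mathfrak X\to\mathbb C$ by $g_{v,j}(x)=0$ if $x\notin\dot U_v$ and $$g_{v,j}(x)=\Bigl(\sum_{i=0}^{h(x)-h(v)-1}q^{-i}\Bigr)a_{v,j}\bigl(p^{h(x)-h(v)-1}(x)\bigr)\quad\text{if }x\in\dot U_v .$$ The constants. For $n\in\mathbb Z$, $$b_{n,\alpha}=q^{-\alpha n}\sum_{l=0}^{+\infty}q^{-\alpha(l+1)}\Bigl(\sum_{i=0}^{l}q^{-i}\Bigr)\Bigl(\sum_{j=0}^{l}q^{j}\Bigr).$$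 *)

(* Defs.v *)
From HB Require Import structures.
From mathcomp Require Import all_boot all_order all_algebra finmap.
From mathcomp Require Import complex.
From mathcomp Require Import all_classical all_reals all_analysis.
From mathcomp Require Import summability.

Set Implicit Arguments.
Unset Strict Implicit.
Unset Printing Implicit Defensive.
Import Order.TTheory GRing.Theory Num.Theory.
Import numFieldNormedType.Exports.
Local Open Scope classical_set_scope.
Local Open Scope ring_scope.

Section Tree.
Context {V : choiceType} (adj : rel V).

(* [ucycle] includes the cycles x - y - x of size 2, which are backtrackings
   and not cycles of the graph; size 1 is excluded by irreflexivity. *)
Definition homogeneous_tree (q : nat) : Prop :=
  [/\ irreflexive adj,
      symmetric adj,
      (exists x : V, True) /\
        (forall x y : V, exists2 s : seq V, path adj x s & last x s = y),
      (forall c : seq V, ucycle adj c -> (size c <= 2)%N) &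
      forall x : V, ([set y | adj x y] #= `I_q.+1)%card].

Definition infinite_chain (c : nat -> V) : Prop :=
  forall i, adj (c i) (c i.+1) /\ c i <> c i.+2.

(* The index i + m is nonnegative for large i, so the absolute value is
   harmless. *)
Definition chain_equiv (c c' : nat -> V) : Prop :=
  exists m : int, \forall i \near \oo, c i = c' `|(i%:Z + m)%R|%N.

Definition boundary_point (omega : set (nat -> V)) : Prop :=
  exists2 c, infinite_chain c &
    omega = [set c' | infinite_chain c' /\ chain_equiv c c'].

Definition walk_length (x y : V) (n : nat) : Prop :=
  exists s : seq V, [/\ path adj x s, last x s = y & size s = n].

Definition dist (x y : V) : nat :=
  xget 0%N [set n | walk_length x y n /\
                    forall m, walk_length x y m -> (n <= m)%N].

(* [xget d A] is an element of A, or d if A is empty; each of the sets below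
   to which it is applied is a singleton when [adj] is a homogeneous tree,
   [omega] a boundary point and [H0] a horocycle. *)
Section Boundary.
Variable omega : set (nat -> V).

Definition ray (x : V) : nat -> V :=
  xget (fun=> x) [set c | omega c /\ c 0%N = x].

Definition raypts (x : V) : set V := range (ray x).

Definition confluent (x y : V) : V :=
  xget x [set z | raypts x `&` raypts y = raypts z].

Definition same_horocycle (x y : V) : Prop :=
  dist x (confluent x y) = dist y (confluent x y).

Definition is_horocycle (H : set V) : Prop :=
  exists x, H = [set y | same_horocycle x y].

Definition sector (x : V) : set V := [set y | raypts x `<=` raypts y].

Definition dsector (x : V) : set V := sector x `\ x.

Section Horocycle.
Variable H0 : set V.

Definition horocycle (k : int) : set V :=
  [set x | exists2 y, H0 y &
             (dist x (confluent x y))%:Z = (dist y (confluent x y))%:Z + k].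

Definition hindex (x : V) : int := xget 0 [set k | horocycle k x].

Definition predecessor (x : V) : V :=
  xget x [set y | adj x y /\ horocycle (hindex x - 1) y].

Definition successors (x : V) : set V :=
  [set y | adj x y /\ y <> predecessor x].

End Horocycle.
End Boundary.
End Tree.

Section Bergman.
Context {R : realType} {V : choiceType} (adj : rel V) (q : nat)
  (omega : set (nat -> V)) (H0 : set V).
Local Notation C := R[i].
Local Notation h := (hindex adj omega H0).
Local Notation p := (predecessor adj omega H0).
Local Notation S := (successors adj omega H0).

Definition harmonic_fun (f : V -> C) : Prop :=
  forall x, f x = (q.+1%:R)^-1 * \sum_(y \in [set y | adj x y]) f y.

Definition weight (alpha : R) (x : V) : R := q%:R `^ (- alpha * (h x)%:~R).

Definition bergman (alpha : R) : set (V -> C) :=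
  [set f | harmonic_fun f /\
    (\esum_(x in [set: V])
       (ComplexField.Normc.normc (f x) ^+ 2 * weight alpha x)%:E < +oo)%E].

(* [summability.sum] is the limit of the net of finite partial sums. *)
Definition bergman_inner (alpha : R) (f g : V -> C) : C :=
  summability.sum
    ((fun x => f x * (g x)^* * (weight alpha x)%:C%C) : V -> C^o).

Definition bergman_norm (alpha : R) (f : V -> C) : R :=
  Num.sqrt (complex.Re (bergman_inner alpha f f)).

(* Orthonormal basis in the Hilbert space sense: the finite linear combinations
   of the family are dense. *)
Definition bergman_orthonormal_basis (alpha : R) (I : choiceType)
    (e : I -> V -> C) : Prop :=
  [/\ forall i, bergman alpha (e i),
      forall i j, bergman_inner alpha (e i) (e j) = (i == j)%:R &
      forall f, bergman alpha f -> forall eps : R, 0 < eps ->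
        exists (F : {fset I}) (c : I -> C),
          bergman_norm alpha
            (fun x => f x - \sum_(i <- F) c i * e i x) < eps].

(* Functions on S v are represented by functions on V of which only the values
   on S v matter. *)
Definition Z_space (v : V) : set (V -> C) :=
  [set phi | \sum_(x \in S v) phi x = 0].

Definition Z_orthonormal_basis (v : V) (n : nat) (a : 'I_n -> V -> C) : Prop :=
  [/\ forall j, Z_space v (a j),
      forall j k, \sum_(x \in S v) a j x * (a k x)^* = (j == k)%:R &
      forall phi, Z_space v phi -> exists c : 'I_n -> C,
        forall x, S v x -> phi x = \sum_j c j * a j x].

(* For x in the punctured sector, h x - h v - 1 is a natural number m, and the
   sum over i = 0, ..., m has m.+1 terms. *)
Definition g_fun (v : V) (phi : V -> C) (x : V) : C :=
  if x \in dsector omega v then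
    let m := `|(h x - h v - 1)%R|%N in
    (\sum_(i < m.+1) q%:R ^- i) * phi (iter m p x)
  else 0.

Definition b_const (n : int) (alpha : R) : R :=
  q%:R `^ (- alpha * n%:~R) *
  limn (series (fun l : nat => q%:R `^ (- alpha * l.+1%:R) *
    (\sum_(i < l.+1) q%:R ^- i) * (\sum_(j < l.+1) q%:R ^+ j))).

End Bergman.

(* Main.v *)
Require Import Defs.
From HB Require Import structures.
From mathcomp Require Import all_boot all_order all_algebra finmap.
From mathcomp Require Import complex.
From mathcomp Require Import all_classical all_reals all_analysis.
From mathcomp Require Import summability.
From mathcomp Require Import zify ring lra.
Set Implicit Arguments.
Unset Strict Implicit.
Unset Printing Implicit Defensive.
Import Order.TTheory GRing.Theory Num.Theory.
Import numFieldNormedType.Exports.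
Local Open Scope classical_set_scope.
Local Open Scope ring_scope.

(** For a harmonic [f] put [D x = f x - f (p x)], where [p] is the predecessor.
Harmonicity at [x] says that [D x] is the sum of [D] over the successors of
[x], so on [S v] the increment [D] is the constant [D v / q] plus an element
[branching f v] of [Z_v]. The function [g_{v,j}] is the harmonic function all
of whose components [branching _ u] vanish except the one at [u = v], which is
[a_{v,j}] ([branching_horo_fun]).

The sum of [f] over the [l]-th generation of descendants of a vertex is an
explicit combination of [f] and [D] at that vertex ([sum_generation]). Summing
over the generations in the sector of [v], this gives
[<f, g_{v,j}> = b_{h(v)} <branching f v, a_{v,j}>] for every [f] in the Bergman
space ([horo_fun_pairing]). Taking for [f] another function of the family
yields orthonormality.

For density, the increments telescope along the ray from [x] to [omega]: the
functions [g_{v, branching f v}], for [v] among the [n] nearest ancestors of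
[x], add up at [x] to [f x] minus a remainder that only involves [f] at the
[n]-th and [n+1]-st ancestors ([branching_expansion]). The weights grow
geometrically towards [omega], so that square-summability forces the remainder
to vanish ([l2_decay]). Thus the Fourier partial sums of [f] approach [f]
uniformly on every finite set of vertices ([horo_fun_series_approx]). Norm
approximation follows from Bessel's inequality ([orthonormal_dense]): take a
finite set carrying almost all of the squared norm of [f] and a partial sum [T]
close to [f] there; then the squared norm of [T] is almost that of [f], and the
squared norm of [f - T] is the difference of the two.

The facts about the tree behind all this are that every vertex has one
predecessor, of index smaller by one, and [q] successors. To derive them from the
definitions of boundary points and horocycles, one shows that each vertex [x] starts exactly
one chain of the class [omega] ([omega_through], [omega_start_inj]). This chain
is the orbit of [x] under a map [parent], two vertices are adjacent if and only
if one is the parent of the other, and the horocyclic index counts generations. *)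

(** * Chains converging to a boundary point *)

Section Chains.
Context {V : choiceType} (adj : rel V) (q : nat).
Hypothesis tree : homogeneous_tree adj q.

Let adj_irr : irreflexive adj. Proof. by case: tree. Qed.
Let adj_sym : symmetric adj. Proof. by case: tree. Qed.

(** Between two visits of the same vertex, chosen as close as possible, the walk
would be a cycle without repetition, hence of length at most two; length one is
excluded by irreflexivity and length two by non-backtracking. *)
Lemma nonbacktracking_inj (w : nat -> V) (n : nat) :
  (forall i, (i < n)%N -> adj (w i) (w i.+1)) ->
  (forall i, (i.+1 < n)%N -> w i <> w i.+2) ->
  forall i j, (i < j <= n)%N -> w i <> w j.
Proof.
move=> wadj wnb.
suff main d : forall i, (i + d.+1 <= n)%N -> w i <> w (i + d.+1)%N.
  move=> i j ijn; have := main (j - i.+1)%N i.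
  have -> : (i + (j - i.+1).+1)%N = j by lia.
  by apply; lia.
have [m] := ubnP d; elim: m d => // m IH d; rewrite ltnS => dm i idn wij.
have [_ _ _ acyclic _] := tree.
have szc : size [seq w k | k <- iota i d.+1] = d.+1 by rewrite size_map size_iota.
have : (d.+1 <= 2)%N.
  rewrite -szc; apply: acyclic; apply/andP; split.
    rewrite /= [X in rcons _ X]wij -map_rcons.
    have -> : rcons (iota i.+1 d) (i + d.+1)%N = iota i.+1 d.+1.
      by have := iotaD i.+1 d 1; rewrite addn1 => ->; rewrite -cats1 /= addSnnS.
    apply/(pathP (w 0%N)) => k; rewrite size_map size_iota => kd.
    rewrite -map_cons (nth_map 0%N) /= ?size_iota; last by lia.
    rewrite -[i :: _ :: _]/(iota i d.+2) -[w i.+1 :: _]/(map w (iota i.+1 d.+1)).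
    rewrite (nth_map 0%N) ?size_iota // !nth_iota //; last by lia.
    by rewrite addSn; apply: wadj; lia.
  suff winj : {in iota i d.+1 &, injective w} by rewrite map_inj_in_uniq ?iota_uniq.
  move=> k l; rewrite !mem_iota => hk hl wkl.
  have [klt|klt|//] := ssrnat.ltngtP k l; exfalso.
    have := IH (l - k.+1)%N _ k; have -> : (k + (l - k.+1).+1)%N = l by lia.
    by apply => //; lia.
  have := IH (k - l.+1)%N _ l; have -> : (l + (k - l.+1).+1)%N = k by lia.
  by apply => //; lia.
case: d => [|[|//]] in dm idn wij szc *.
  have : adj (w i) (w i.+1) by apply: wadj; lia.
  by rewrite -addn1 -wij adj_irr.
by move=> _; apply: (wnb i); [lia|rewrite wij; congr w; lia].
Qed.

Lemma infinite_chain_inj c : infinite_chain adj c -> injective c.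
Proof.
move=> cc i j cij; have inj k l : (k < l)%N -> c k <> c l.
  move=> kl; apply: (@nonbacktracking_inj c l).
  - by move=> m _; case: (cc m).
  - by move=> m _; case: (cc m).
  - by rewrite kl /=.
by have [/inj|/inj|//] := ssrnat.ltngtP i j; rewrite cij.
Qed.

(** Running down [u] from [u m] to the common origin and then up [v] to [v n] is
a non-backtracking walk, because the chains separate at the first step. *)
Lemma chains_branch_disjoint (u v : nat -> V) (m n : nat) :
  infinite_chain adj u -> infinite_chain adj v -> u 0%N = v 0%N ->
  u 1%N <> v 1%N -> (0 < m)%N -> u m <> v n.
Proof.
move=> cu cv uv0 uv1 m0.
pose w i := if (i < m)%N then u (m - i)%N else v (i - m)%N.
have wm : w 0%N <> w (m + n)%N.
  apply: (@nonbacktracking_inj w (m + n)); last by lia.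
  - move=> i _; rewrite /w.
    case: (ltnP i m) => im; case: (ltnP i.+1 m) => im' => //; first last.
    + by rewrite subSn//; case: (cv (i - m)%N).
    + by lia.
    + have -> : (m - i = 1)%N by lia.
      have -> : (i.+1 - m = 0)%N by lia.
      by rewrite -uv0 adj_sym; case: (cu 0%N).
    + have -> : (m - i = (m - i.+1).+1)%N by lia.
      by rewrite adj_sym; case: (cu (m - i.+1)%N).
  - move=> i _; rewrite /w.
    case: (ltnP i m) => im; case: (ltnP i.+2 m) => im' => //; first last.
    + by rewrite !subSn//; [case: (cv (i - m)%N)|lia].
    + by lia.
    + have [->|->] : (m = i.+1 \/ m = i.+2)%N by lia.
        by rewrite subSnn; have -> : (i.+2 - i.+1 = 1)%N by lia.
      rewrite subnn -uv0; have -> : (i.+2 - i = 2)%N by lia.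
      by move=> /esym; case: (cu 0%N).
    + have -> : (m - i = (m - i.+2).+2)%N by lia.
      by move=> /esym; case: (cu (m - i.+2)%N).
move: wm; rewrite /w m0 subn0; case: ltnP => [|_]; first by lia.
by have -> : (m + n - m = n)%N by lia.
Qed.

Lemma chain_equivP (c c' : nat -> V) :
  chain_equiv c c' <-> exists m n, forall i, c (m + i)%N = c' (n + i)%N.
Proof.
split=> [[k [N _ kN]]|[m [n mn]]].
  exists (N + `|k|)%N, `|((N + `|k|)%N%:Z + k)%R|%N => i.
  by rewrite kN /=; [congr c'; lia|lia].
exists (n%:Z - m%:Z); exists m => //= i /= mi.
have im : i = (m + (i - m))%N by lia.
by rewrite {1}im mn; congr c'; lia.
Qed.

Context (omega : set (nat -> V)).
Hypothesis omega_bd : boundary_point adj omega.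

Lemma omega_chain c : omega c -> infinite_chain adj c.
Proof. by case: omega_bd => c0 _ -> []. Qed.

Lemma omega_tails c c' : omega c -> omega c' ->
  exists m n, forall i, c (m + i)%N = c' (n + i)%N.
Proof.
case: omega_bd => c0 _ -> [_ /chain_equivP[m [n mn]]].
move=> [_ /chain_equivP[m' [n' mn']]].
exists (n + m')%N, (n' + m)%N => i.
by rewrite -addnA -mn addnCA mn' addnA.
Qed.

Lemma omega_tail_closed c c' m n : omega c -> infinite_chain adj c' ->
  (forall i, c (m + i)%N = c' (n + i)%N) -> omega c'.
Proof.
case: omega_bd => c0 _ -> [_ /chain_equivP[k [l kl]]] cc' mn; split => //.
apply/chain_equivP; exists (k + m)%N, (n + l)%N => i.
by rewrite -addnA kl addnCA mn addnA.
Qed.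

(** Two chains that split at some point never meet again, whereas the tails of
equivalent chains coincide. *)
Lemma omega_start_inj c c' : omega c -> omega c' -> c 0%N = c' 0%N -> c = c'.
Proof.
move=> oc oc' cc0; apply/funext => i; apply/eqP/negPn/negP => cci.
have ex : exists k, c k != c' k by exists i.
have [[|k] kn kmin] := ex_minnP ex; first by rewrite cc0 eqxx in kn.
have ck : c k = c' k.
  by apply/eqP/negPn/negP => /kmin; rewrite ltnn.
have shift d : infinite_chain adj d -> infinite_chain adj (fun i => d (k + i)%N).
  by move=> dc j; have := dc (k + j)%N; rewrite !addnS.
have [m [n mn]] := omega_tails oc oc'.
have := @chains_branch_disjoint _ _ (m + 1)%N (n + 1)%N
  (shift _ (omega_chain oc)) (shift _ (omega_chain oc')).
rewrite /= !addn0 !addn1 => /(_ ck); apply => //.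
  exact/eqP.
rewrite (_ : k + m.+1 = m + k.+1)%N; last by lia.
by rewrite mn; congr c'; lia.
Qed.

(** The vertices that start a chain of the class form a set closed under
adjacency: for a neighbour, either drop the first vertex of the chain or prepend
the neighbour. Connectedness does the rest. *)
Lemma omega_through (x : V) : exists c, omega c /\ c 0%N = x.
Proof.
have [c0 oc0] : exists c, omega c.
  case: omega_bd => c cc ->; exists c; split => //.
  by apply/chain_equivP; exists 0%N, 0%N.
have [_ _ [_ /(_ (c0 0%N) x)[s cs <-]] _ _] := tree.
have : exists c, omega c /\ c 0%N = c0 0%N by exists c0.
elim: s (c0 0%N) cs => [//|z s IH y + [c [oc cy]]] /=; rewrite -{}cy.
move=> /andP[yz zs]; apply: (IH _ zs) => {IH zs}.
have cc := omega_chain oc.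
have [zc|zc] := eqVneq z (c 1%N).
  exists (fun i => c i.+1); split => //.
  apply: (@omega_tail_closed c _ 1%N 0%N) => // i; exact: (cc i.+1).
exists (fun i => if i is j.+1 then c j else z); split => //.
apply: (@omega_tail_closed c _ 0%N 1%N) => // -[|i]; last exact: cc.
by split; [rewrite adj_sym|exact/eqP].
Qed.

Lemma ray_omega x : omega (ray omega x) /\ ray omega x 0%N = x.
Proof. exact: (xgetPex (fun=> x) (omega_through x)). Qed.

(** The predecessor, obtained from rays alone: the horocycles, in terms of which
[predecessor] is defined, are analysed by means of it
(see [predecessor_parent]). *)
Definition parent (x : V) : V := ray omega x 1%N.

Lemma ray_unique c : omega c -> ray omega (c 0%N) = c.
Proof.
by move=> oc; have [or r0] := ray_omega (c 0%N); exact: omega_start_inj.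
Qed.

Lemma ray_iter x n : ray omega x n = iter n parent x.
Proof.
elim: n => [|n IH]; first by case: (ray_omega x).
rewrite iterS -IH /parent.
have [or _] := ray_omega x.
pose c i := ray omega x (n + i)%N.
have oc : omega c.
  apply: (@omega_tail_closed (ray omega x) _ n 0%N) => // i.
  by have := omega_chain or (n + i)%N; rewrite /c !addnS.
by have := ray_unique oc; rewrite /c addn0 => ->; rewrite addn1.
Qed.

Lemma iter_parent_inj x m n : iter m parent x = iter n parent x -> m = n.
Proof.
by rewrite -!ray_iter; apply/infinite_chain_inj/omega_chain; case: (ray_omega x).
Qed.

(** A neighbour [y] of [x] other than [parent x] can be prepended to the ray of
[x], and the result is the ray of [y]. *)
Lemma adj_parentE x y : adj x y = (y == parent x) || (parent y == x).
Proof.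
have [or r0] := ray_omega x; have rc := omega_chain or.
apply/idP/orP => [xy|]; last first.
  case=> [/eqP ->|/eqP <-]; first by have [+ _] := rc 0%N; rewrite r0.
  by rewrite adj_sym; have [oy y0] := ray_omega y; have [+ _] := omega_chain oy 0%N;
     rewrite y0.
have [yp|yp] := eqVneq y (parent x); [by left|right].
pose c i := if i is j.+1 then ray omega x j else y.
have oc : omega c.
  apply: (@omega_tail_closed (ray omega x) _ 0%N 1%N) => // -[|i]; last exact: rc.
  by split; [rewrite /= r0 adj_sym|exact/eqP].
by rewrite /parent (ray_unique oc) /= r0.
Qed.

(** * Generations and the horocyclic index *)

Lemma common_ancestor x y :
  exists m n, iter m parent x = iter n parent y.
Proof.
have [ox _] := ray_omega x; have [oy _] := ray_omega y.
have [m [n mn]] := omega_tails ox oy; exists m, n.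
by rewrite -!ray_iter -[m]addn0 mn addn0.
Qed.

(** A horocyclic index relative to an arbitrary origin [y]; it does not depend on
the common ancestor by [generation_gapE]. *)
Definition generation_gap (x y : V) : int :=
  xget 0 [set k | exists m n, iter m parent x = iter n parent y /\ k = m%:Z - n%:Z].

Lemma generation_gapE x y m n :
  iter m parent x = iter n parent y -> generation_gap x y = m%:Z - n%:Z.
Proof.
move=> mn; rewrite /generation_gap; case: xgetP => [k _ [m' [n' [mn' ->]]]|]; last first.
  by move=> /(_ (m%:Z - n%:Z)); case; exists m, n.
have : iter (n' + m) parent x = iter (n + m') parent x.
  rewrite iterD mn -iterD addnC iterD -mn' -iterD; congr (iter _ _ _).
by move=> /iter_parent_inj; lia.
Qed.

Lemma generation_gap_parent x y :
  generation_gap (parent x) y = generation_gap x y - 1.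
Proof.
have [m [n mn]] := common_ancestor (parent x) y.
rewrite (generation_gapE mn) (@generation_gapE _ _ m.+1 n) ?iterSr//; lia.
Qed.

Lemma generation_gap_iter m x y :
  generation_gap (iter m parent x) y = generation_gap x y - m%:Z.
Proof.
by elim: m => [|m IH]; rewrite ?subr0// iterS generation_gap_parent IH; lia.
Qed.

Lemma generation_gap_refl x : generation_gap x x = 0.
Proof. by rewrite (@generation_gapE x x 0 0). Qed.

Lemma generation_gap_walk x y n z : walk_length adj x y n ->
  `|generation_gap x z - generation_gap y z| <= n%:Z.
Proof.
case=> s [+ <- <-]; elim: s x => [|w s IH] x /=; first by rewrite subrr.
move=> /andP[xw /IH].
suff : `|generation_gap x z - generation_gap w z| <= 1 by lia.
move: xw; rewrite adj_parentE => /orP[/eqP ->|/eqP <-]; rewrite ?generation_gap_parent; lia.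
Qed.

(** Each step of a walk changes the generation by one, so no walk from [x] to its
[m]-th ancestor has fewer than [m] steps. *)
Lemma dist_iter_parent x m : dist adj x (iter m parent x) = m.
Proof.
have walkm : walk_length adj x (iter m parent x) m.
  elim: m => [|m [s [ps ls ss]]]; first by exists [::].
  exists (rcons s (iter m.+1 parent x)); rewrite last_rcons size_rcons ss.
  by rewrite rcons_path ps ls /= adj_parentE eqxx.
have walkge k : walk_length adj x (iter m parent x) k -> (m <= k)%N.
  move=> /(@generation_gap_walk _ _ _ x).
  by rewrite generation_gap_iter generation_gap_refl; lia.
rewrite /dist; case: xgetP => [k _ [wk kmin]|/(_ m)]; last by case.
by apply/eqP; rewrite eqn_leq kmin//= walkge.
Qed.

Lemma raypts_iter x : raypts omega x = [set y | exists n, iter n parent x = y].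
Proof.
apply/seteqP; split => y /=; first by case=> n _ <-; exists n; rewrite ray_iter.
by case=> n <-; exists n => //; rewrite ray_iter.
Qed.

(** The confluent is the first ancestor of [x] that is also an ancestor of [y]:
from there on the two rays coincide. *)
Lemma confluentE x y : exists m n,
  [/\ confluent omega x y = iter m parent x,
      confluent omega x y = iter n parent y &
      generation_gap x y = m%:Z - n%:Z].
Proof.
have ex : exists m, `[< exists n, iter m parent x = iter n parent y >].
  by have [m [n mn]] := common_ancestor x y; exists m; apply/asboolP; exists n.
have [m /asboolP[n mn] mmin] := ex_minnP ex.
exists m, n.
suff -> : confluent omega x y = iter m parent x.
  by split => //; exact: generation_gapE.
have meet : raypts omega x `&` raypts omega y = raypts omega (iter m parent x).
  rewrite !raypts_iter; apply/seteqP; split => z /=.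
    case=> -[i ix] [j jy]; exists (i - m)%N; rewrite -iterD subnK//.
    by apply: mmin; apply/asboolP; exists j; rewrite ix jy.
  case=> i <-; split; first by exists (i + m)%N; rewrite iterD.
  by exists (i + n)%N; rewrite iterD mn.
rewrite /confluent; case: xgetP => [z _ /=|/(_ _ meet)//]; rewrite meet !raypts_iter.
move=> /seteqP[/(_ (iter m parent x)) + /(_ z)] /=.
move=> /(_ (ex_intro _ 0%N erefl))[i zi] /(_ (ex_intro _ 0%N erefl))[j].
move: zi; set u := iter m parent x => zi uj.
have : iter (j + i) parent z = iter 0 parent z by rewrite iterD zi.
by move=> /iter_parent_inj; case: i zi => [//|i] _; rewrite addnS.
Qed.

Lemma dist_confluent x y :
  (dist adj x (confluent omega x y))%:Z - (dist adj y (confluent omega x y))%:Z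
  = generation_gap x y.
Proof.
by have [m [n [xm yn ->]]] := confluentE x y; rewrite {1}xm yn !dist_iter_parent.
Qed.

Context (H0 : set V).
Hypothesis H0_horo : is_horocycle adj omega H0.

Lemma generation_gap_trans x y z :
  generation_gap x z = generation_gap x y + generation_gap y z.
Proof.
have [m [n mn]] := common_ancestor x y; have [k [l kl]] := common_ancestor y z.
rewrite (generation_gapE mn) (generation_gapE kl).
rewrite (@generation_gapE _ _ (k + m) (n + l)); first by lia.
by rewrite iterD mn -iterD addnC iterD kl -iterD.
Qed.

Lemma horocycle_gap x0 : H0 = [set y | same_horocycle adj omega x0 y] ->
  forall k x, horocycle adj omega H0 k x <-> generation_gap x x0 = k.
Proof.
move=> H0E k x.
have gap0 y : H0 y <-> generation_gap x0 y = 0.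
  by rewrite H0E /= /same_horocycle -dist_confluent; split; lia.
have horoE : horocycle adj omega H0 k x <-> exists2 y, H0 y & generation_gap x y = k.
  by split=> -[y Hy xy]; exists y => //; move: xy; rewrite -dist_confluent; lia.
rewrite horoE; split => [[y /gap0 Hy <-]|<-]; last first.
  by exists x0 => //; apply/gap0; rewrite generation_gap_refl.
rewrite (generation_gap_trans x x0 y) Hy; lia.
Qed.

Lemma hindex_gap x0 : H0 = [set y | same_horocycle adj omega x0 y] ->
  forall x, hindex adj omega H0 x = generation_gap x x0.
Proof.
move=> /horocycle_gap H0E x; rewrite /hindex; case: xgetP => [k _ /H0E//|].
by move=> /(_ (generation_gap x x0)) /=; rewrite H0E.
Qed.

Lemma predecessor_parent x : predecessor adj omega H0 x = parent x.
Proof.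
have [x0 /[dup] H0E /hindex_gap hE] := H0_horo; have horoE := horocycle_gap H0E.
rewrite /predecessor; case: xgetP => [y _ [+ /horoE]|]; last first.
  move=> /(_ (parent x)); case; split; first by rewrite adj_parentE eqxx.
  by apply/horoE; rewrite generation_gap_parent hE.
by rewrite adj_parentE hE => /orP[/eqP//|/eqP <-]; rewrite generation_gap_parent; lia.
Qed.

Lemma predecessorE : predecessor adj omega H0 = parent.
Proof. by apply/funext => x; rewrite predecessor_parent. Qed.

Lemma adj_predecessorE x y :
  adj x y = (y == predecessor adj omega H0 x) || (predecessor adj omega H0 y == x).
Proof. by rewrite predecessorE adj_parentE. Qed.

Lemma hindex_predecessor x :
  hindex adj omega H0 (predecessor adj omega H0 x) = hindex adj omega H0 x - 1.
Proof.
have [x0 /hindex_gap hE] := H0_horo.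
by rewrite predecessorE !hE generation_gap_parent.
Qed.

Lemma dsectorE v : dsector omega v =
  [set x | exists n, iter n.+1 (predecessor adj omega H0) x = v].
Proof.
rewrite predecessorE; apply/seteqP; split => x /=.
  case; rewrite /sector /= !raypts_iter => /(_ v (ex_intro _ 0%N erefl))[[|n] xv vx].
    by case: vx.
  by exists n.
case=> n xv; split; rewrite /sector /= ?raypts_iter.
  by move=> y [m <-]; exists (m + n.+1)%N; rewrite iterD -xv.
move=> xv'; have : iter n.+1 parent x = iter 0 parent x.
  exact: etrans (xv : iter n.+1 parent x = v) (esym xv').
by move=> /iter_parent_inj.
Qed.

Lemma successorsE v : successors adj omega H0 v =
  [set x | predecessor adj omega H0 x = v].
Proof.
rewrite /successors predecessorE; apply/seteqP; split => x /=.
  by case; rewrite adj_parentE => /orP[/eqP//|/eqP].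
move=> xv; split; first by rewrite adj_parentE xv eqxx orbT.
move=> xp; have : iter 2 parent x = iter 0 parent x by rewrite /= xv xp.
by move=> /iter_parent_inj.
Qed.

Lemma finite_successors v : finite_set (successors adj omega H0 v).
Proof.
have [_ _ _ _ /(_ v) degv] := tree.
by apply: (@sub_finite_set _ _ [set y | adj v y]); [move=> y []|exists q.+1].
Qed.

Lemma neighbours_predecessor v : [set y | adj v y] =
  predecessor adj omega H0 v |` successors adj omega H0 v.
Proof.
apply/seteqP; split => y /=.
  rewrite /successors /=.
  by have [->|/eqP yv] := eqVneq y (predecessor adj omega H0 v); [left|right].
by case=> [->|[vy _]]; [rewrite adj_predecessorE eqxx|exact: vy].
Qed.

Lemma card_successors v : #|` fset_set (successors adj omega H0 v)| = q.
Proof.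
have [_ _ _ _ /(_ v)/card_fset_set] := tree.
rewrite neighbours_predecessor fset_setU1; last exact: finite_successors.
have pS : predecessor adj omega H0 v \notin successors adj omega H0 v.
  by rewrite notin_setE => -[].
by rewrite cardfsU1 in_fset_set ?pS; [case|exact: finite_successors].
Qed.
End Chains.
(** * Unconditional sums of complex families *)

#[local] Existing Instance totally_filter.

Section NetSums.
Context {R : realType} {V : choiceType}.
Local Notation C := R[i].
Local Notation normc := ComplexField.Normc.normc.

(** Convergence of the net of finite partial sums stated as a relation, so that
convergence is carried along when sums are combined linearly. *)
Definition has_sum (F : V -> C) (s : C) : Prop :=
  partial_sum (F : V -> C^o) A @[A --> totally] --> (s : C^o).

Lemma normc_normE (z : C) : `|z| = (normc z)%:C%C.
Proof. by []. Qed.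

Lemma normc_ge0 (z : C) : 0 <= normc z.
Proof. by rewrite -ler0c -normc_normE. Qed.

Lemma normc_real (x : R) : normc x%:C%C = `|x|.
Proof. by rewrite /= expr0n addr0 sqrtr_sqr. Qed.

Lemma normc_sqr (z : C) : (normc z ^+ 2)%:C%C = z * z^*.
Proof. by rewrite rmorphXn /= -normc_normE normCK. Qed.

Lemma normc_conj (z : C) : normc z^* = normc z.
Proof. by apply: complexI; rewrite -!normc_normE norm_conjC. Qed.

Lemma conj_realC (x : R) : (x%:C%C)^* = x%:C%C :> C.
Proof. exact: conjc_real. Qed.

Lemma normcN (z : C) : normc (- z) = normc z.
Proof. by apply: complexI; rewrite -!normc_normE normrN. Qed.

Lemma le_normcD (x y : C) : normc (x + y) <= normc x + normc y.
Proof. by rewrite -lecR rmorphD /= -!normc_normE ler_normD. Qed.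

Lemma le_normc_sum (I : Type) (r : seq I) (F : I -> C) :
  normc (\sum_(i <- r) F i) <= \sum_(i <- r) normc (F i).
Proof.
elim/big_rec2: _ => [|i y x _ yx]; first by rewrite ComplexField.Normc.normc0.
by apply: (le_trans (le_normcD _ _)); rewrite lerD2l.
Qed.

Lemma has_sumP (F : V -> C) (s : C) :
  has_sum F s <-> forall e : R, 0 < e -> exists A0 : {fset V},
    forall A : {fset V}, (A0 `<=` A)%fset -> normc (\sum_(x <- A) F x - s) < e.
Proof.
rewrite /has_sum; split => [/cvgrPdist_lt Fs e e0|Fs].
  have e0' : (0 : C) < e%:C%C by rewrite ltcR.
  have [A0 _ HA0] := Fs _ e0'.
  exists A0 => A /HA0 /=.
  by rewrite distrC /partial_sum (big_seq_fsetE _ _ predT) normc_normE ltcR.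
apply/cvgrPdist_lt => e; rewrite ltcE /= => /andP[/eqP Ime Ree].
have [A0 HA0] := Fs _ Ree; exists A0 => // A /HA0 /=.
rewrite distrC /partial_sum (big_seq_fsetE _ _ predT) normc_normE.
by rewrite ltcE /= Ime eqxx.
Qed.

Lemma has_sum_sum (F : V -> C) (s : C) :
  has_sum F s -> summability.sum (F : V -> C^o) = s.
Proof. by move=> Fs; exact: (@cvg_lim C^o (@norm_hausdorff C C^o)). Qed.

Lemma has_sum0 : has_sum (fun=> 0) 0.
Proof.
apply/has_sumP => e e0; exists fset0 => A _.
by rewrite big1// subr0 ComplexField.Normc.normc0.
Qed.

Lemma has_sumD (F G : V -> C) (s t : C) :
  has_sum F s -> has_sum G t -> has_sum (fun x => F x + G x) (s + t).
Proof.
move=> Fs Gt; rewrite /has_sum.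
rewrite (_ : partial_sum _ = partial_sum (F : V -> C^o) \+ partial_sum (G : V -> C^o)).
  exact: (@cvgD _ C^o _ _ _ _ _ _ _ Fs Gt).
by apply/funext => A; rewrite /partial_sum /= big_split.
Qed.

Lemma has_sumZ (c : C) (F : V -> C) (s : C) :
  has_sum F s -> has_sum (fun x => c * F x) (c * s).
Proof.
move=> Fs; rewrite /has_sum.
rewrite (_ : partial_sum _ = c \*o partial_sum (F : V -> C^o)).
  exact: cvgMr.
by apply/funext => A; rewrite /partial_sum /= mulr_sumr.
Qed.

Lemma has_sum_bigsum (I : Type) (r : seq I) (F : I -> V -> C) (s : I -> C) :
  (forall i, has_sum (F i) (s i)) ->
  has_sum (fun x => \sum_(i <- r) F i x) (\sum_(i <- r) s i).
Proof.
move=> Fs; elim: r => [|i r IH].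
  by rewrite big_nil; under eq_fun do rewrite big_nil; exact: has_sum0.
rewrite big_cons; under eq_fun do rewrite big_cons.
exact: (has_sumD (Fs i) IH).
Qed.

Lemma ler_sum_fsubset (u : V -> R) (A B : {fset V}) : (forall x, 0 <= u x) ->
  (A `<=` B)%fset -> \sum_(x <- A) u x <= \sum_(x <- B) u x.
Proof.
move=> u0 AB; rewrite (big_fsetID _ (mem A) B) /=.
have -> : [fset x in B | x \in A]%fset = A.
  by apply/fsetP => x; rewrite !inE andb_idl// => /(fsubsetP AB).
by rewrite lerDl sumr_ge0.
Qed.

Lemma has_sum_nonneg (u : V -> R) (M : R) : (forall x, 0 <= u x) ->
  (forall A : {fset V}, \sum_(x <- A) u x <= M) ->
  (forall e, 0 < e -> exists A : {fset V}, M - e < \sum_(x <- A) u x) ->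
  has_sum (fun x => (u x)%:C%C) M%:C%C.
Proof.
move=> u0 uM Mu; apply/has_sumP => e /Mu[A0 HA0]; exists A0 => A /(ler_sum_fsubset u0) A0A.
by rewrite -rmorph_sum -rmorphB normc_real ler0_norm ?subr_le0 ?uM//; lra.
Qed.

Lemma has_sum_nonneg_le (u : V -> R) (s : C) : (forall x, 0 <= u x) ->
  has_sum (fun x => (u x)%:C%C) s ->
  forall A : {fset V}, \sum_(x <- A) u x <= complex.Re s.
Proof.
move=> u0 /has_sumP us A; apply/ler_addgt0Pr => e /us[A0 HA0].
have := HA0 (A0 `|` A)%fset (fsubsetUl _ _).
rewrite -rmorph_sum => B.
have AB := ler_sum_fsubset u0 (fsubsetUr A0 A).
have : `|complex.Re ((\sum_(x <- (A0 `|` A)%fset) u x)%:C%C - s)| < e.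
  by rewrite -ltcR (le_lt_trans (normc_ge_Re _))// normc_normE ltcR.
by case: (s) => a b /=; rewrite ltr_norml => /andP[_]; lra.
Qed.

Lemma eventually_fset (T : choiceType) (A : {fset T}) (P : nat -> T -> Prop) :
  (forall x, x \in A -> exists n0, forall n, (n0 <= n)%N -> P n x) ->
  exists n0, forall n, (n0 <= n)%N -> forall x, x \in A -> P n x.
Proof.
move=> AP; have /choice[n0 Hn0] : forall x, exists n0, x \in A ->
    forall n, (n0 <= n)%N -> P n x.
  by move=> x; case: (boolP (x \in A)) => [/AP[n0]|]; [exists n0|exists 0%N].
exists (\sum_(x <- A) n0 x)%N => n An x xA; apply: Hn0 => //.
by apply: leq_trans An; rewrite (big_fsetD1 x)//= leq_addr.
Qed.

(** For an absolutely bounded family, a finite set carrying almost all of the sum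
of absolute values leaves little outside it; hence the limit along any exhaustion
of the support is the limit of the net. *)
Lemma has_sum_exhaustion (F : V -> C) (M : R) (s : C) (D : nat -> {fset V}) :
  (forall A : {fset V}, \sum_(x <- A) normc (F x) <= M) ->
  (forall x, F x != 0 -> exists n0, forall n, (n0 <= n)%N -> x \in D n) ->
  normc (\sum_(x <- D n) F x - s) @[n --> \oo] --> 0 ->
  has_sum F s.
Proof.
move=> FM FD Ds; pose u x := normc (F x).
have u0 x : 0 <= u x by exact: normc_ge0.
pose U := [set \sum_(x <- A) u x | A in [set: {fset V}]].
have supU : has_sup U.
  by split; [exists (\sum_(x <- fset0) u x), fset0|exists M => _ [A _ <-]].
apply/has_sumP => e e0; have e20 : 0 < e / 2 by rewrite divr_gt0.
have [_ [A0 _ <-] A0U] := sup_adherent e20 supU.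
have [n1 Hn1] : exists n1, forall n, (n1 <= n)%N ->
    forall x, x \in A0 -> F x != 0 -> x \in D n.
  apply: (@eventually_fset _ A0 (fun n x => F x != 0 -> x \in D n)) => x _.
  by have [Fx|/FD[n0 H]] := eqVneq (F x) 0; [exists 0%N|exists n0 => n /H].
move/cvgrPdist_lt: Ds => /(_ _ e20)[n2 _ Hn2].
have := Hn1 _ (leq_maxl n1 n2); have := Hn2 _ (leq_maxr n1 n2).
move: (maxn n1 n2) => n; rewrite /= sub0r normrN ger0_norm ?normc_ge0// => nearD A0D.
exists (D n) => A DA.
pose B := (A `\` D n)%fset.
have -> : \sum_(x <- A) F x - s = \sum_(x <- B) F x + (\sum_(x <- D n) F x - s).
  rewrite (big_fsetID _ (mem (D n)) A) /=.
  have -> : [fset x in A | x \in D n]%fset = D n.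
    by apply/fsetP => x; rewrite !inE andb_idl// => /(fsubsetP DA).
  have -> : [fset x in A | x \notin D n]%fset = B.
    by apply/fsetP => x; rewrite !inE andbC.
  by rewrite addrAC addrC.
apply: (le_lt_trans (le_normcD _ _)); rewrite (splitr e) ltr_leD// ?ltW//.
apply: (le_lt_trans (le_normc_sum _ _)).
have -> : \sum_(x <- B) normc (F x) = \sum_(x <- (B `\` A0)%fset) u x.
  rewrite (big_fsetID _ (mem A0) B) /= big1_seq ?add0r => [|x].
    by apply: eq_fbigl => x; rewrite !inE andbC.
  rewrite !inE => /andP[_ /andP[/andP[xD _] xA0]].
  have [->|Fx] := eqVneq (F x) 0; first by rewrite ComplexField.Normc.normc0.
  by rewrite A0D in xD.
have : \sum_(x <- (A0 `|` (B `\` A0))%fset) u x <= sup U.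
  by apply: (sup_upper_bound supU); exists (A0 `|` (B `\` A0))%fset.
rewrite (big_fsetID _ (mem A0) (A0 `|` _)%fset) /=.
have -> : [fset x in A0 `|` B `\` A0 | x \in A0]%fset = A0.
  by apply/fsetP => x; rewrite !inE; case: (x \in A0); rewrite ?andbF.
have -> : [fset x in A0 `|` B `\` A0 | x \notin A0]%fset = (B `\` A0)%fset.
  by apply/fsetP => x; rewrite !inE; case: (x \in A0); rewrite ?andbF ?andbT.
lra.
Qed.
End NetSums.
(** * Orthonormal families in weighted square-summable functions *)

Section OrthonormalFamilies.
Context {R : realType} {V I : choiceType} (w : V -> R).
Local Notation C := R[i].
Local Notation normc := ComplexField.Normc.normc.
Hypothesis w_ge0 : forall x, 0 <= w x.

Definition l2_term (f g : V -> C) (x : V) : C := f x * (g x)^* * (w x)%:C%C.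

Definition l2_bounded (f : V -> C) (M : R) : Prop :=
  forall A : {fset V}, \sum_(x <- A) normc (f x) ^+ 2 * w x <= M.

Lemma l2_termE (f : V -> C) x : l2_term f f x = (normc (f x) ^+ 2 * w x)%:C%C.
Proof. by rewrite /l2_term -normc_sqr [RHS]rmorphM. Qed.

Lemma l2_sqr_ge0 (f : V -> C) x : 0 <= normc (f x) ^+ 2 * w x.
Proof. by rewrite mulr_ge0// sqr_ge0. Qed.

Lemma has_sum_conj (F : V -> C) s : has_sum F s -> has_sum (fun x => (F x)^*) s^*.
Proof.
move=> /has_sumP Fs; apply/has_sumP => e /Fs[A0 HA0]; exists A0 => A /HA0.
by rewrite -rmorph_sum -rmorphB /= normc_conj.
Qed.

Lemma has_sum_l2_sym f g s :
  has_sum (l2_term f g) s -> has_sum (l2_term g f) s^*.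
Proof.
move=> /has_sum_conj; congr has_sum; apply/funext => x.
by rewrite /l2_term !rmorphM /= conjCK conj_realC [_^* * _]mulrC.
Qed.

Lemma has_sum_l2_comb (r : seq I) (a : I -> C) (g : I -> V -> C) f s :
  (forall i, has_sum (l2_term (g i) f) (s i)) ->
  has_sum (l2_term (fun x => \sum_(i <- r) a i * g i x) f)
    (\sum_(i <- r) a i * s i).
Proof.
move=> gs; have := @has_sum_bigsum _ _ _ r _ _ (fun i => @has_sumZ _ _ (a i) _ _ (gs i)).
congr has_sum; apply/funext => x; rewrite /l2_term !mulr_suml.
by apply: eq_bigr => i _; rewrite !mulrA.
Qed.

Lemma has_sum_l2_self f M : l2_bounded f M ->
  exists N : R, [/\ has_sum (l2_term f f) N%:C%C, l2_bounded f N &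
    forall e, 0 < e -> exists A : {fset V},
      N - e < \sum_(x <- A) normc (f x) ^+ 2 * w x].
Proof.
move=> fM; pose u x := normc (f x) ^+ 2 * w x.
pose U := [set \sum_(x <- A) u x | A in [set: {fset V}]].
have supU : has_sup U.
  by split; [exists (\sum_(x <- fset0) u x), fset0|exists M => _ [A _ <-]].
have le_sup (A : {fset V}) : \sum_(x <- A) u x <= sup U.
  by apply: (sup_upper_bound supU); exists A.
have sup_lt e : 0 < e -> exists A : {fset V}, sup U - e < \sum_(x <- A) u x.
  by move=> /sup_adherent/(_ supU)[_ [A _ <-]]; exists A.
exists (sup U); split => //.
rewrite (_ : l2_term f f = fun x => (u x)%:C%C).
  by apply: has_sum_nonneg => // x; exact: l2_sqr_ge0.
by apply/funext => x; rewrite l2_termE.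
Qed.

Context (e : I -> V -> C).
Hypothesis e_orthonormal : forall i j, has_sum (l2_term (e i) (e j)) (i == j)%:R.

Context (f : V -> C) (c : I -> C).
Hypothesis coefE : forall i, has_sum (l2_term f (e i)) (c i).

Let T (F : {fset I}) (x : V) : C := \sum_(i <- F) c i * e i x.
Let S (F : {fset I}) : R := \sum_(i <- F) normc (c i) ^+ 2.

Let has_sum_Tf F : has_sum (l2_term (T F) f) (S F)%:C%C.
Proof.
have := @has_sum_l2_comb F c _ _ _ (fun i => has_sum_l2_sym (@coefE i)).
congr has_sum; rewrite /S rmorph_sum; apply: eq_bigr => i _.
by rewrite -normc_sqr.
Qed.

Let has_sum_TT F : has_sum (l2_term (T F) (T F)) (S F)%:C%C.
Proof.
have Te j : has_sum (l2_term (e j) (T F)) (\sum_(i <- F) c i * (i == j)%:R)^*.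
  have eT := @has_sum_l2_comb F c e (e j) _ (fun i => @e_orthonormal i j).
  exact: (has_sum_l2_sym eT).
have := @has_sum_l2_comb F c _ _ _ Te.
congr has_sum; rewrite /S rmorph_sum; apply: eq_big_seq => j jF.
rewrite (big_fsetD1 j)//= eqxx mulr1 big1_seq ?addr0; first by rewrite -normc_sqr.
by move=> i; rewrite !inE => /andP[_ /andP[/negbTE -> _]]; rewrite mulr0.
Qed.

Lemma bessel_partial (F : {fset I}) (A : {fset V}) :
  \sum_(x <- A) normc (T F x) ^+ 2 * w x <= S F.
Proof.
have := @has_sum_nonneg_le _ _ (fun x => normc (T F x) ^+ 2 * w x) (S F)%:C%C.
apply; first by move=> x; exact: l2_sqr_ge0.
have := @has_sum_TT F; congr has_sum.
by apply/funext => x; rewrite l2_termE.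
Qed.

Lemma pythagoras (N : R) (F : {fset I}) : has_sum (l2_term f f) N%:C%C ->
  has_sum (l2_term (fun x => f x - T F x) (fun x => f x - T F x)) (N - S F)%:C%C.
Proof.
move=> fN; have fT := has_sum_l2_sym (@has_sum_Tf F).
have := has_sumD (has_sumD fN (@has_sumZ _ _ (-1) _ _ (@has_sum_Tf F)))
  (has_sumD (@has_sumZ _ _ (-1) _ _ fT) (@has_sum_TT F)).
rewrite !mulN1r conj_realC addNr addr0 -rmorphB.
congr has_sum; apply/funext => x.
by rewrite /l2_term rmorphB /=; ring.
Qed.

(** Fatou's argument: pointwise approximation by Fourier partial sums [T F] gives,
on a finite set [X] carrying the squared norm [N] of [f] up to [eta], that the
squared norm of [T F] is at least [N - 2 eta]. By Pythagoras the squared norm of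
the residual is then at most [2 eta]. *)
Lemma orthonormal_dense (M : R) : l2_bounded f M ->
  (forall (X : {fset V}) (d : R), 0 < d ->
     exists F : {fset I}, forall x, x \in X -> normc (f x - T F x) < d) ->
  forall eps : R, 0 < eps -> exists F : {fset I},
    Num.sqrt (complex.Re (summability.sum
      (l2_term (fun x => f x - T F x) (fun x => f x - T F x) : V -> C^o))) < eps.
Proof.
move=> /has_sum_l2_self[N [fN Nub Nlub]] approx eps eps0.
have eta0 : 0 < eps ^+ 2 / 2 by rewrite divr_gt0// exprn_gt0.
have [X NX] := Nlub _ eta0; set eta := eps ^+ 2 / 2 in eta0 NX.
(* [K] bounds the effect of a pointwise error on the weighted square sum over
   [X], by |f|^2 - |T|^2 <= 2 |f| |f - T|; the 1 makes it positive. *)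
pose K := 1 + \sum_(x <- X) 2 * normc (f x) * w x.
have K0 : 0 < K.
  by rewrite ltr_pwDl// sumr_ge0// => x _; rewrite !mulr_ge0// normc_ge0.
have [F TF] := approx X (eta / K) (divr_gt0 eta0 K0).
exists F; rewrite (has_sum_sum (@pythagoras N F fN)) /=.
suff NS : N - S F < eps ^+ 2.
  have [NSneg|NSpos] := leP (N - S F) 0; first by rewrite ler0_sqrtr.
  by rewrite -[ltRHS](ger0_norm (ltW eps0)) -sqrtr_sqr ltr_sqrt ?exprn_gt0.
have := bessel_partial F X.
suff : \sum_(x <- X) normc (f x) ^+ 2 * w x - eta
    <= \sum_(x <- X) normc (T F x) ^+ 2 * w x.
  by rewrite /eta in NX *; lra.
rewrite lerBlDr; have etaK : \sum_(x <- X) 2 * normc (f x) * w x * (eta / K) <= eta.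
  rewrite -mulr_suml mulrA ler_pdivrMr// [leLHS]mulrC ler_pM2l// /K; lra.
rewrite -lerBlDl; apply: le_trans etaK; rewrite -sumrB !big_seq ler_sum// => x xX.
have := TF x xX; have : normc (f x) <= normc (T F x) + normc (f x - T F x).
  by rewrite (le_trans _ (le_normcD _ _))// addrC subrK.
have := w_ge0 x; have := normc_ge0 (f x); have := normc_ge0 (T F x).
move: (normc (f x)) (normc (T F x)) (normc (f x - T F x)) (w x) (eta / K) => a b d wx k.
move=> b0 a0 wx0 abd dk; rewrite -mulrBl -[leRHS]mulrAC ler_wpM2r//.
have abk : 0 <= a * (k - (a - b)) by apply: mulr_ge0 => //; lra.
have := sqr_ge0 (a - b); nra.
Qed.
End OrthonormalFamilies.
(** * Harmonic functions along the generations of a sector *)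

Section HorocyclicTree.
Context {R : realType} {V : choiceType} (q : nat) (p : V -> V) (h : V -> int).
Local Notation C := R[i].
Local Notation normc := ComplexField.Normc.normc.
Hypothesis h_p : forall x, h (p x) = h x - 1.

Lemma h_iter n x : h (iter n p x) = h x - n%:Z.
Proof. by elim: n => [|n IH]; rewrite ?subr0// iterS h_p IH; lia. Qed.

Lemma iter_p_inj n m x : iter n p x = iter m p x -> n = m.
Proof. by move=> /(congr1 h); rewrite !h_iter; lia. Qed.

Definition geo (n : nat) : C := \sum_(i < n) q%:R ^- i.
Definition qsum (n : nat) : C := \sum_(i < n) q%:R ^+ i.

Lemma geo0 : geo 0 = 0. Proof. by rewrite /geo big_ord0. Qed.

Lemma geoSr n : geo n.+1 = geo n + q%:R ^- n.
Proof. by rewrite /geo big_ord_recr. Qed.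

Lemma geoSl n : geo n.+1 = 1 + geo n / q%:R.
Proof.
rewrite /geo big_ord_recl expr0 invr1 mulr_suml; congr (_ + _).
by apply: eq_bigr => i _; rewrite exprSr invfM.
Qed.

Lemma qsumSr n : qsum n.+1 = qsum n + q%:R ^+ n.
Proof. by rewrite /qsum big_ord_recr. Qed.

Lemma qsumSl n : qsum n.+1 = 1 + qsum n * q%:R.
Proof.
rewrite /qsum big_ord_recl expr0 mulr_suml; congr (_ + _).
by apply: eq_bigr => i _; rewrite exprSr.
Qed.

(** The function [g_{v,j}] for a general profile [phi] on the successors of [v];
membership in the punctured sector is expressed by iterates of [p]. *)
Definition horo_fun (v : V) (phi : V -> C) (x : V) : C :=
  if x \in [set x | exists n, iter n.+1 p x = v] then
    let m := `|(h x - h v - 1)%R|%N in geo m.+1 * phi (iter m p x)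
  else 0.

Lemma horo_fun_in v phi n x : iter n.+1 p x = v ->
  horo_fun v phi x = geo n.+1 * phi (iter n p x).
Proof.
move=> xv; rewrite /horo_fun ifT; last by rewrite inE; exists n.
have -> // : `|(h x - h v - 1)%R|%N = n.
by rewrite -xv h_iter; lia.
Qed.

Lemma horo_fun_out v phi x : (forall n, iter n.+1 p x <> v) -> horo_fun v phi x = 0.
Proof. by move=> xv; rewrite /horo_fun ifF// memNset// => -[n /xv]. Qed.

Lemma horo_fun_neq0 v phi x : horo_fun v phi x != 0 -> exists n, iter n.+1 p x = v.
Proof. by rewrite /horo_fun; case: ifPn => [|_ /eqP//]; rewrite inE. Qed.

Lemma horo_fun_root v phi : horo_fun v phi v = 0.
Proof. by apply: horo_fun_out => n /(@iter_p_inj _ 0). Qed.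

Lemma horo_fun_child v phi y : p y = v -> horo_fun v phi y = phi y.
Proof.
by move=> yv; rewrite (@horo_fun_in _ _ 0)// geoSr geo0 add0r expr0 invr1 mul1r.
Qed.

Lemma sector_cases v x : [\/ exists n, iter n.+1 p x = v, x = v |
  forall n, iter n p x <> v].
Proof.
have [[n xv]|xv] := pselect (exists n, iter n p x = v).
  by case: n xv => [|n] xv; [constructor 2|constructor 1; exists n].
by constructor 3 => n xnv; apply: xv; exists n.
Qed.

Lemma horo_fun_parent v phi n x : iter n.+1 p x = v ->
  horo_fun v phi (p x) = geo n * phi (iter n p x).
Proof.
case: n => [<-|n]; first by rewrite horo_fun_root geo0 mul0r.
by rewrite iterSr => /horo_fun_in ->; rewrite -iterSr.
Qed.

Definition children (v : V) : {fset V} := fset_set [set x | p x = v].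
Hypothesis children_finite : forall v, finite_set [set x | p x = v].
Hypothesis card_children : forall v, #|` children v| = q.

Lemma in_children v x : (x \in children v) = (p x == v).
Proof.
rewrite in_fset_set; last exact: children_finite.
by apply/idP/eqP; rewrite inE.
Qed.

(** The recursion goes through the successors of the root, so that sums over a
generation reduce to sums over earlier generations of the successors. *)
Fixpoint generation (n : nat) (v : V) : {fset V} :=
  if n is m.+1 then (\bigcup_(y <- children v) generation m y)%fset else [fset v]%fset.

Lemma in_generation n v x : (x \in generation n v) = (iter n p x == v).
Proof.
elim: n v => [|n IH] v /=; first by rewrite inE.
apply/bigfcupP/eqP => [[y /andP[]]|xv]; first by rewrite in_children IH => /eqP <- _ /eqP ->.
by exists (iter n p x); rewrite ?IH// in_children xv eqxx.
Qed.

Lemma sum_generationS (E : zmodType) (F : V -> E) n v :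
  \sum_(x <- generation n.+1 v) F x =
  \sum_(y <- children v) \sum_(x <- generation n y) F x.
Proof.
rewrite /=; apply: partition_disjoint_bigfcup => y z _ _ yz.
apply/fdisjointP => x; rewrite !in_generation => /eqP xy.
by rewrite xy.
Qed.

Lemma sum_children_const (c : C) v : \sum_(y <- children v) c = q%:R * c.
Proof.
by rewrite big_const_seq count_predT iter_addr addr0 -(card_children v) mulr_natl.
Qed.

Hypothesis q_ge2 : (2 <= q)%N.

Lemma q_neq0 : q%:R != 0 :> C.
Proof. by rewrite pnatr_eq0; lia. Qed.

(** Harmonicity with the neighbours sorted into successors and predecessor. *)
Definition horo_harmonic (f : V -> C) : Prop :=
  forall x, \sum_(y <- children x) f y + f (p x) = q.+1%:R * f x.

(** The component in [Z_v] of the increments of [f] on the edges below [v]: the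
sum of these increments is [f v - f (p v)] when [f] is harmonic, so this
subtracts their mean. *)
Definition branching (f : V -> C) (v y : V) : C :=
  f y - f v - (f v - f (p v)) / q%:R.

Lemma sum_branching f v : horo_harmonic f ->
  \sum_(y <- children v) branching f v y = 0.
Proof.
move=> /(_ v) fv; rewrite /branching !sumrB !sum_children_const.
have -> : \sum_(y <- children v) f y = q.+1%:R * f v - f (p v).
  by rewrite -fv addrK.
by rewrite [_ * (_ / _)]mulrC divfK ?q_neq0// -natr1; ring.
Qed.

(** By harmonicity, the sum over the successors of [y] of the increments of [f]
is the increment at [y]; so passing to the next generation multiplies the sum of
[f] by [q] and adds [f y - f (p y)]. *)
Lemma sum_generation f l y : horo_harmonic f ->
  \sum_(x <- generation l y) f x = q%:R ^+ l * f y + qsum l * (f y - f (p y)).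
Proof.
move=> fh; elim: l y => [|l IH] y.
  by rewrite big_seq_fset1 /qsum big_ord0 mul1r mul0r addr0.
rewrite sum_generationS (eq_big_seq (fun z => (q%:R ^+ l + qsum l) * f z - qsum l * f y)).
  rewrite sumrB -mulr_sumr sum_children_const.
  have -> : \sum_(z <- children y) f z = q.+1%:R * f y - f (p y).
    by rewrite -(fh y) addrK.
  have Q : q%:R ^+ l = 1 + qsum l * q%:R - qsum l by rewrite -qsumSl qsumSr; ring.
  by rewrite qsumSr exprS Q -natr1; ring.
by move=> z; rewrite in_children IH => /eqP ->; ring.
Qed.

(** Along a branch the coefficients [geo] satisfy
[q * geo n.+2 + geo n = (q + 1) * geo n.+1]; at [v] harmonicity is the condition
that [phi] has sum zero. *)
Lemma horo_fun_harmonic v phi : \sum_(y <- children v) phi y = 0 ->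
  horo_harmonic (horo_fun v phi).
Proof.
move=> phi0 x; have [[n xv]|->|xv] := sector_cases v x.
- rewrite (horo_fun_in _ xv) (horo_fun_parent _ xv).
  rewrite (eq_big_seq (fun=> geo n.+2 * phi (iter n p x))); last first.
    move=> y; rewrite in_children => /eqP yx.
    have yv : iter n.+2 p y = v by rewrite iterSr yx.
    by rewrite (horo_fun_in _ yv) iterSr yx.
  rewrite sum_children_const !mulrA -mulrDl; congr (_ * _).
  rewrite -natr1 mulrDl mul1r [geo n.+2]geoSl mulrDr [_ * (_ / _)]mulrC divfK ?q_neq0//.
  by rewrite addrAC; congr (_ + _); rewrite geoSl mulrDr [_ * (_ / _)]mulrC divfK ?q_neq0.
- rewrite horo_fun_root mulr0 [X in _ + X]horo_fun_out ?addr0; last first.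
    by move=> n; rewrite -iterSr => /(@iter_p_inj _ 0).
  rewrite -[RHS]phi0; apply: eq_big_seq => y; rewrite in_children => /eqP yv.
  exact: horo_fun_child.
- rewrite horo_fun_out ?mulr0; last by move=> n; rewrite -iterSr; exact: xv.
  rewrite [horo_fun _ _ x]horo_fun_out ?mulr0; last by move=> n; exact: xv.
  rewrite addr0 big1_seq// => y /= /[!in_children] /eqP yx.
  by apply: horo_fun_out => n; rewrite iterSr yx; exact: xv.
Qed.

(** Below the successors of [u], the increment of the function is divided by [q]
at each generation, equally along all branches; so nothing is left once the mean
is removed. *)
Lemma branching_horo_fun u phi v y : p y = v ->
  branching (horo_fun u phi) v y = if v == u then phi y else 0.
Proof.
move=> yv; rewrite /branching; have [vu|vu] := eqVneq v u.
  rewrite (horo_fun_child _ (etrans yv vu)) vu horo_fun_root.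
  rewrite [horo_fun u phi (p u)]horo_fun_out ?subr0 ?mul0r ?subr0// => n.
  by rewrite -iterSr => /(@iter_p_inj _ 0).
have [[n vu']|/eqP|vu'] := sector_cases u v; last 2 first.
- by rewrite (negPf vu).
- rewrite (@horo_fun_out u _ y); last by move=> n; rewrite iterSr yv.
  rewrite (@horo_fun_out u _ v); last by move=> n; exact: vu'.
  rewrite (@horo_fun_out u _ (p v)) ?subr0 ?mul0r ?subr0// => n.
  by rewrite -iterSr; exact: vu'.
rewrite (horo_fun_in _ vu') (horo_fun_parent _ vu').
have yu : iter n.+2 p y = u by rewrite iterSr yv.
rewrite (horo_fun_in _ yu) iterSr yv.
rewrite -!mulrBl -mulrAC -mulrBl.
rewrite (geoSr n.+1) [geo n.+1 + _]addrC addrK (geoSr n) [geo n + _]addrC addrK.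
by rewrite exprSr invfM subrr mul0r.
Qed.

(** On the descendants of a successor [y] of [v] the second function is constant
along the generation, so [sum_generation] applies; whatever does not depend on
[y] is killed by the zero sum of [phi]. *)
Lemma level_pairing f v phi l : horo_harmonic f ->
  \sum_(y <- children v) phi y = 0 ->
  \sum_(x <- generation l.+1 v) f x * (horo_fun v phi x)^* =
  geo l.+1 * qsum l.+1 * \sum_(y <- children v) branching f v y * (phi y)^*.
Proof.
move=> fh phi0; have geo_real : (geo l.+1)^* = geo l.+1.
  rewrite rmorph_sum; apply: eq_bigr => i _.
  by rewrite fmorphV rmorphXn rmorph_nat.
have phi0' : \sum_(y <- children v) (phi y)^* = 0.
  by rewrite -rmorph_sum phi0 rmorph0.
rewrite sum_generationS.
(* The part of the sum of [f] below [y] that is independent of [y]. *)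
pose K := q%:R ^+ l * f v + qsum l.+1 * ((f v - f (p v)) / q%:R).
rewrite (eq_big_seq (fun y => geo l.+1 * (qsum l.+1 * (branching f v y * (phi y)^*)
    + K * (phi y)^*))).
  by rewrite -mulr_sumr big_split /= -!mulr_sumr phi0' mulr0 addr0 mulrA.
move=> y; rewrite in_children => /eqP yv.
rewrite (eq_big_seq (fun x => f x * (geo l.+1 * (phi y)^*))).
  rewrite -mulr_suml sum_generation// yv /K /branching qsumSr; ring.
move=> x; rewrite in_generation => /eqP xy.
by rewrite (@horo_fun_in _ _ l) ?iterS ?xy// rmorphM /= geo_real.
Qed.

(** The functions supported in the sectors of the first [n] ancestors of [x] add
up to [f] at [x] up to a term seen from the [n]-th ancestor. *)
Lemma branching_expansion f x n :
  \sum_(k < n) horo_fun (iter k.+1 p x) (branching f (iter k.+1 p x)) x =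
  f x - f (iter n p x) - (f (iter n p x) - f (iter n.+1 p x)) * (geo n / q%:R).
Proof.
elim: n => [|n IH]; first by rewrite big_ord0 geo0 mul0r mulr0 subrr subr0.
rewrite big_ord_recr /= IH (@horo_fun_in _ _ n)//= /branching /=.
by rewrite geoSl; move: (geo n / _) => r; rewrite -!/(iter _ p x); ring.
Qed.
(** * Weights and square-summability *)

Context (alpha : R).
Hypothesis alpha_gt1 : 1 < alpha.

Definition hweight (x : V) : R := q%:R `^ (- alpha * (h x)%:~R).

(** The general term of the series in [b_const]. *)
Definition bterm (l : nat) : R := q%:R `^ (- alpha * l.+1%:R) *
  (\sum_(i < l.+1) q%:R ^- i) * (\sum_(j < l.+1) q%:R ^+ j).

Lemma q_gt0 : 0 < q%:R :> R.
Proof. by rewrite ltr0n; lia. Qed.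

Lemma q_ge2R : 2 <= q%:R :> R.
Proof. by rewrite ler_nat. Qed.

Lemma hweight_gt0 x : 0 < hweight x.
Proof. by rewrite powR_gt0 ?q_gt0. Qed.

Lemma hweight_shift (k : int) x y : h x = h y + k ->
  hweight x = hweight y * q%:R `^ (- alpha * k%:~R).
Proof.
move=> xy; rewrite /hweight xy rmorphD mulrDr powRD//.
by apply/implyP => _; rewrite gt_eqF ?q_gt0.
Qed.

Lemma geo_realE n : geo n = (\sum_(i < n) q%:R ^- i : R)%:C%C.
Proof.
by rewrite rmorph_sum; apply: eq_bigr => i _; rewrite fmorphV rmorphXn rmorph_nat.
Qed.

Lemma qsum_realE n : qsum n = (\sum_(i < n) q%:R ^+ i : R)%:C%C.
Proof.
by rewrite rmorph_sum; apply: eq_bigr => i _; rewrite rmorphXn rmorph_nat.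
Qed.

Lemma geo_le2 n : \sum_(i < n) q%:R ^- i <= 2 :> R.
Proof.
elim: n => [|n IH]; first by rewrite big_ord0.
rewrite big_ord_recl expr0 invr1 (_ : 2 = 1 + 1)// lerD2l.
rewrite (eq_bigr (fun i : 'I_n => q%:R ^- i / q%:R)) => [|i _]; last first.
  by rewrite exprSr invfM.
by rewrite -mulr_suml ler_pdivrMr ?q_gt0// mul1r (le_trans IH)// q_ge2R.
Qed.

Lemma qsum_le n : \sum_(i < n) q%:R ^+ i <= q%:R ^+ n :> R.
Proof.
elim: n => [|n IH]; first by rewrite big_ord0 expr0.
rewrite big_ord_recr /= exprS.
have := exprn_ge0 n (ltW q_gt0); have := q_ge2R; nra.
Qed.

Lemma geo_ge0 n : 0 <= \sum_(i < n) q%:R ^- i :> R.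
Proof. by apply: sumr_ge0 => i _; rewrite invr_ge0 exprn_ge0// ltW ?q_gt0. Qed.

Lemma qsum_ge0 n : 0 <= \sum_(i < n) q%:R ^+ i :> R.
Proof. by apply: sumr_ge0 => i _; rewrite exprn_ge0// ltW ?q_gt0. Qed.

Lemma bterm_ge0 l : 0 <= bterm l.
Proof. by rewrite /bterm !mulr_ge0 ?powR_ge0 ?geo_ge0 ?qsum_ge0. Qed.

(** The two geometric sums are at most [2] and [q ^ l.+1], so the series is
dominated by a geometric one of ratio [q ^ (1 - alpha) < 1]. *)
Lemma bterm_series_cvg : cvgn (series bterm).
Proof.
pose r : R := q%:R `^ (1 - alpha).
have r0 : 0 < r by rewrite powR_gt0 ?q_gt0.
have r1 : r < 1.
  rewrite /r /powR gt_eqF ?q_gt0// expR_lt1 nmulr_rlt0 ?subr_lt0//.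
  by rewrite ln_gt0// (lt_le_trans _ q_ge2R)// ltr1n.
apply: (@series_le_cvg _ _ (geometric (2 * r) r)) => [||n|].
- exact: bterm_ge0.
- by move=> n /=; rewrite !mulr_ge0 ?exprn_ge0// ltW.
- have rE : r ^+ n.+1 = q%:R `^ (- alpha * n.+1%:R) * q%:R ^+ n.+1.
    rewrite -powR_mulrn ?ltW// -powRrM mulrBl mul1r -mulNr addrC powRD.
      by rewrite powR_mulrn ?ltW ?q_gt0.
    by apply/implyP => _; rewrite gt_eqF ?q_gt0.
  rewrite /= -mulrA -exprS rE /bterm -mulrA mulrCA.
  by rewrite ler_pM ?geo_ge0 ?geo_le2 ?mulr_ge0 ?powR_ge0 ?qsum_ge0// ler_wpM2l ?powR_ge0 ?qsum_le.
- by apply: is_cvg_geometric_series; rewrite ger0_norm// ltW.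
Qed.

Lemma bterm_series_le n : series bterm n <= limn (series bterm).
Proof.
apply: nondecreasing_cvgn_le; last exact: bterm_series_cvg.
by apply: nondecreasing_series => k _ _; exact: bterm_ge0.
Qed.

Definition bconst (v : V) : R := hweight v * limn (series bterm).

Lemma bconst_gt0 v : 0 < bconst v.
Proof.
rewrite mulr_gt0 ?hweight_gt0// (lt_le_trans _ (bterm_series_le 1))//.
rewrite seriesEord /= big_ord1 /bterm !big_ord1 !expr0 invr1 !mulr1.
by rewrite powR_gt0 ?q_gt0.
Qed.

Fixpoint sector_upto (n : nat) (v : V) : {fset V} :=
  if n is m.+1 then (sector_upto m v `|` generation n v)%fset else fset0.

Lemma in_sector_upto n v x : x \in sector_upto n v <->
  exists2 l, (l < n)%N & iter l.+1 p x = v.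
Proof.
elim: n => [|n IH]; first by split=> // -[].
rewrite [sector_upto _ _]/(_ `|` _)%fset in_fsetU in_generation.
split=> [/orP[/IH[l ln xv]|/eqP xv]|[l]].
- by exists l => //; exact: ltnW.
- by exists n.
- rewrite ltnS leq_eqVlt => /orP[/eqP -> xv|ln xv].
    by apply/orP; right; exact/eqP.
  by apply/orP; left; apply/IH; exists l.
Qed.

Lemma sum_sector_upto (E : zmodType) (F : V -> E) n v :
  \sum_(x <- sector_upto n v) F x =
  \sum_(l < n) \sum_(x <- generation l.+1 v) F x.
Proof.
elim: n => [|n IH]; first by rewrite big_ord0 big_seq_fset0.
rewrite big_ord_recr -IH [sector_upto _ _]/(_ `|` _)%fset.
rewrite (big_fsetID _ (mem (sector_upto n v))) /=; congr (_ + _); apply: eq_fbigl => x.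
  by rewrite !inE /= andb_orl andbb; case: (x \in sector_upto _ _); rewrite ?andbT ?andbF.
rewrite !inE /=; case: (boolP (x \in sector_upto n v)) => //= [/in_sector_upto[l ln xv]|_].
  apply/esym/negP; rewrite -/(generation n.+1 v) in_generation -xv => /eqP/iter_p_inj.
  by lia.
by rewrite andbT.
Qed.

Lemma series_pairing f v phi n : horo_harmonic f ->
  \sum_(y <- children v) phi y = 0 ->
  \sum_(x <- sector_upto n v) l2_term hweight f (horo_fun v phi) x =
  (hweight v * series bterm n)%:C%C *
  \sum_(y <- children v) branching f v y * (phi y)^*.
Proof.
move=> fh phi0; rewrite sum_sector_upto seriesEord /= [hweight v * _]mulr_sumr rmorph_sum mulr_suml.
apply: eq_bigr => l _.
rewrite (eq_big_seq (fun x => f x * (horo_fun v phi x)^* *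
    (hweight v * q%:R `^ (- alpha * l.+1%:R))%:C%C)).
  rewrite -mulr_suml level_pairing// geo_realE qsum_realE /bterm !rmorphM /=; ring.
move=> x; rewrite (in_generation l.+1 v x) => /eqP xv; rewrite /l2_term.
by rewrite (@hweight_shift l.+1%:Z x v)// -xv h_iter; lia.
Qed.

(** The square sums over the truncated sectors are given by [series_pairing] with
both functions equal, and bounded by the sum of the whole series. *)
Lemma horo_fun_l2_bounded v phi : \sum_(y <- children v) phi y = 0 ->
  exists M, l2_bounded hweight (horo_fun v phi) M.
Proof.
move=> phi0; pose S := \sum_(y <- children v) normc (phi y) ^+ 2.
have S0 : 0 <= S by apply: sumr_ge0 => y _; exact: sqr_ge0.
exists (bconst v * S) => A.
pose u x := normc (horo_fun v phi x) ^+ 2 * hweight x.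
have u0 x : 0 <= u x by rewrite mulr_ge0 ?sqr_ge0// ltW ?hweight_gt0.
have [n An] : exists n, forall m, (n <= m)%N -> forall x, x \in A -> u x != 0 ->
    x \in sector_upto m v.
  apply: (@eventually_fset _ A (fun m x => u x != 0 -> x \in sector_upto m v)) => x _.
  have [gx|/horo_fun_neq0[l xv]] := eqVneq (horo_fun v phi x) 0.
    exists 0%N => m _.
    by rewrite /u gx ComplexField.Normc.normc0 expr0n mul0r eqxx.
  by exists l.+1 => m lm _; apply/in_sector_upto; exists l.
have -> : \sum_(x <- A) u x = \sum_(x <- [fset x in A | x \in sector_upto n v]%fset) u x.
  rewrite (big_fsetID _ (mem (sector_upto n v)) A) /= [X in _ + X]big1_seq ?addr0// => x.
  rewrite !inE => /andP[_ /andP[xA]].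
  by have [->//|ux] := eqVneq (u x) 0; rewrite An.
apply: (@le_trans _ _ (\sum_(x <- sector_upto n v) u x)).
  by apply: ler_sum_fsubset => //; apply/fsubsetP => x; rewrite !inE => /andP[].
have -> : \sum_(x <- sector_upto n v) u x = hweight v * series bterm n * S.
  apply: complexI; rewrite rmorphM rmorph_sum /=.
  under eq_bigr do rewrite -l2_termE.
  rewrite (series_pairing n (horo_fun_harmonic phi0) phi0); congr (_ * _).
  rewrite rmorph_sum; apply: eq_big_seq => y.
  rewrite in_children => /eqP yv.
  by rewrite branching_horo_fun// eqxx -normc_sqr.
by rewrite ler_wpM2r// ler_wpM2l ?bterm_series_le// ltW ?hweight_gt0.
Qed.

(** The truncated sectors exhaust the support of the second function, so the limit
of [series_pairing] is the inner product; absolute summability comes from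
[s * t <= s ^+ 2 + t ^+ 2]. *)
Lemma horo_fun_pairing f v phi M : horo_harmonic f -> l2_bounded hweight f M ->
  \sum_(y <- children v) phi y = 0 ->
  has_sum (l2_term hweight f (horo_fun v phi))
    ((bconst v)%:C%C * \sum_(y <- children v) branching f v y * (phi y)^*).
Proof.
move=> fh fM phi0; have [N gN] := horo_fun_l2_bounded phi0.
set P := \sum_(y <- children v) _.
apply: (@has_sum_exhaustion _ _ _ (M + N) _ (fun n => sector_upto n v)).
- move=> A; apply: le_trans (lerD (fM A) (gN A)); rewrite -big_split ler_sum// => x _.
  have wx := hweight_gt0 x; rewrite !ComplexField.Normc.normcM normc_conj normc_real.
  rewrite gtr0_norm// /= -mulrDl ler_wpM2r ?(ltW wx)//.
  move: (normc (f x)) (normc (horo_fun v phi x)) => s t.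
  by have := sqr_ge0 (s - t); have := sqr_ge0 s; have := sqr_ge0 t; nra.
- move=> x; rewrite /l2_term; have [->|/horo_fun_neq0[l xv] _] := eqVneq (horo_fun v phi x) 0.
    by rewrite rmorph0 mulr0 mul0r eqxx.
  by exists l.+1 => n ln; apply/in_sector_upto; exists l.
under eq_fun do rewrite series_pairing// -mulrBl -rmorphB -mulrBr
  ComplexField.Normc.normcM normc_real normrM.
rewrite (_ : 0 = `|hweight v| * `|limn (series bterm) - limn (series bterm)| * normc P).
  apply: cvgMl; apply: cvgMr; apply: cvg_norm; apply: cvgB; last exact: cvg_cst.
  exact: bterm_series_cvg.
by rewrite subrr normr0 mulr0 mul0r.
Qed.

(** Each single term of the square sum is bounded, and the weight at the [n]-th
ancestor is at least [n] times the weight at [x]. *)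
Lemma l2_decay f M x (d : R) : l2_bounded hweight f M -> 0 < d ->
  exists n0, forall n, (n0 <= n)%N -> normc (f (iter n p x)) < d.
Proof.
move=> fM d0; have wx := hweight_gt0 x.
have M0 : 0 <= M by have := fM fset0; rewrite big_seq_fset0.
have K0 : 0 <= M / (hweight x * d ^+ 2) by rewrite divr_ge0// mulr_ge0 ?sqr_ge0// ltW.
exists (Num.Def.archi_bound (M / (hweight x * d ^+ 2))) => n n0n.
have := lt_le_trans (archi_boundP K0) (_ : _ <= n%:R :> R).
rewrite ler_nat => /(_ n0n); rewrite ltr_pdivrMr ?mulr_gt0 ?exprn_gt0// => Mn.
have := fM [fset iter n p x]%fset; rewrite big_seq_fset1.
rewrite (@hweight_shift (- n%:Z) (iter n p x) x) ?h_iter// mulrNz mulrNN.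
set a := normc _ => aM; rewrite ltNge; apply/negP => da.
have nq : n%:R <= q%:R `^ (alpha * n%:~R) :> R.
  have qn : (n <= q ^ n)%N by rewrite ltnW// ltn_expl.
  apply: (@le_trans _ _ (q%:R `^ n%:R)); first by rewrite powR_mulrn// -natrX ler_nat.
  apply: ler_powR; first by rewrite (le_trans _ q_ge2R)// ler1n.
  by rewrite ler_peMl// ltW.
have da2 : d ^+ 2 <= a ^+ 2 by rewrite lerXn2r ?nnegrE ?normc_ge0// ltW.
move: Mn; apply/negP; rewrite -leNgt; apply: le_trans aM.
rewrite mulrCA [leRHS]mulrCA ler_wpM2l ?(ltW wx)// mulrC.
by rewrite ler_pM ?sqr_ge0.
Qed.

(** The set [W] consists of the strict ancestors of points of [X] of index at
least [-N]. Cutting at a common horocycle makes the strict ancestors of [x] in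
[W] exactly its first [h x + N] ones, including those contributed by other points
of [X]; the functions attached to the other members of [W] vanish at [x]. *)
Lemma horo_fun_series_approx f M (X : {fset V}) (d : R) :
  l2_bounded hweight f M -> 0 < d ->
  exists W : {fset V}, forall x, x \in X ->
    normc (f x - \sum_(v <- W) horo_fun v (branching f v) x) < d.
Proof.
move=> fM d0; have d40 : 0 < d / 4 by rewrite divr_gt0.
have [n0 Hn0] : exists n0, forall n, (n0 <= n)%N -> forall x, x \in X ->
    normc (f (iter n p x)) < d / 4.
  by apply: eventually_fset => x _; exact: (l2_decay _ fM).
have [N HN] : exists N, forall n, (N <= n)%N -> forall x, x \in X ->
    n0%:Z <= h x + n%:Z.
  by apply: eventually_fset => x _; exists (n0 + `|h x|)%N => n; lia.
have {}HN := HN _ (leqnn N).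
pose depth x := `|(h x + N%:Z)%R|%N.
pose above x := [fset iter (nat_of_ord k).+1 p x | k in 'I_(depth x)]%fset.
pose W := (\bigcup_(x <- X) above x)%fset.
exists W => x xX.
have xW : (above x `<=` W)%fset by exact: bigfcup_sup.
rewrite -(big_fset_incl _ xW); last first.
  move=> v /bigfcupP[y /andP[yX _] /imfsetP[/= k _ vE]] vx.
  apply/eqP/negPn/negP => /horo_fun_neq0[n xv]; move/negP: vx; apply.
  have nd : (n < depth x)%N.
    have hvy : h v = h y - k.+1%:Z by rewrite vE; exact: (h_iter k.+1 y).
    have hvx : h v = h x - n.+1%:Z by rewrite -xv h_iter.
    have := HN _ yX; have := HN _ xX; have := ltn_ord k; rewrite {2}/depth.
    by move: (nat_of_ord k) hvy => l; rewrite /depth; lia.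
  by apply/imfsetP; exists (Ordinal nd).
rewrite big_imfset /=; last first.
  by move=> k l _ _ kl; apply: val_inj; have [] := iter_p_inj (kl : iter k.+1 p x = iter l.+1 p x).
rewrite big_enum /= branching_expansion.
have xd : (n0 <= depth x)%N by have := HN _ xX; rewrite /depth; lia.
have := Hn0 _ xd _ xX; have := Hn0 _ (leqW xd) _ xX.
set a := f (iter (depth x) p x); set b := f (iter (depth x).+1 p x) => bd ad.
have -> : f x - (f x - a - (a - b) * (geo (depth x) / q%:R)) =
    a + (a - b) * (geo (depth x) / q%:R) by ring.
apply: (le_lt_trans (le_normcD _ _)); rewrite ComplexField.Normc.normcM.
have geo1 : normc (geo (depth x) / q%:R) <= 1.
  rewrite geo_realE -(rmorph_nat (real_complex R)) -fmorphV -rmorphM normc_real.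
  rewrite ger0_norm ?divr_ge0 ?geo_ge0// ler_pdivrMr ?q_gt0// mul1r.
  exact: le_trans (geo_le2 _) q_ge2R.
have abd : normc (a - b) <= normc a + normc b.
  by rewrite (le_trans (le_normcD _ _))// normcN.
have := normc_ge0 (a - b); have := normc_ge0 (geo (depth x) / q%:R).
move: (normc (a - b)) (normc a) (normc b) (normc _) abd ad bd geo1 => s t u k.
by nra.
Qed.
End HorocyclicTree.
(** * The basis of the Bergman space *)

Section Bridge.
Context {R : realType} {V : choiceType} (adj : rel V) (q : nat)
  (omega : set (nat -> V)) (H0 : set V).
Local Notation C := R[i].
Local Notation normc := ComplexField.Normc.normc.
Local Notation h := (hindex adj omega H0).
Local Notation p := (predecessor adj omega H0).
Local Notation S := (successors adj omega H0).
Hypothesis tree : homogeneous_tree adj q.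
Hypothesis omega_bd : boundary_point adj omega.
Hypothesis H0_horo : is_horocycle adj omega H0.

Let SE v : S v = [set x | p x = v].
Proof. exact: (successorsE tree omega_bd H0_horo). Qed.

Lemma sum_successors (F : V -> C) v :
  \sum_(x \in S v) F x = \sum_(x <- children p v) F x.
Proof.
rewrite fsbig_finite; last exact: (finite_successors tree).
by rewrite /children -SE.
Qed.

Lemma harmonic_funE (f : V -> C) :
  harmonic_fun adj q f <-> horo_harmonic q p f.
Proof.
have nbE x : \sum_(y \in [set y | adj x y]) f y = \sum_(y <- children p x) f y + f (p x).
  have finS := finite_successors tree omega H0 x.
  rewrite (neighbours_predecessor tree omega_bd H0_horo) fsbig_finite; last first.
    by rewrite finite_setU; split.
  rewrite fset_setU1// big_fsetU1 /=; first by rewrite addrC /children -SE.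
  by rewrite in_fset_set// notin_setE => -[].
split=> fh x.
  by rewrite [in RHS]fh nbE mulrA divff ?mul1r// pnatr_eq0.
by rewrite nbE fh mulrA mulVf ?mul1r// pnatr_eq0.
Qed.

Lemma g_funE v (phi : V -> C) : g_fun adj q omega H0 v phi = horo_fun q p h v phi.
Proof.
by apply/funext => x; rewrite /g_fun (dsectorE tree omega_bd H0_horo).
Qed.
End Bridge.

Lemma esum_fin_bounded (R : realType) (V : choiceType) (u : V -> R) :
  (forall x, 0 <= u x) ->
  ((\esum_(x in [set: V]) (u x)%:E < +oo)%E <->
   exists M, forall A : {fset V}, \sum_(x <- A) u x <= M).
Proof.
move=> u0; have esum0 : (0 <= \esum_(x in [set: V]) (u x)%:E)%E.
  by apply: esum_ge0 => x _; rewrite lee_fin.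
split=> [ufin|[M uM]].
  exists (fine (\esum_(x in [set: V]) (u x)%:E)) => A.
  rewrite -lee_fin fineK ?ge0_fin_numE//; apply: esum_ge.
  exists [set` A]; first by split => //; exact: finite_fset.
  by rewrite fsbig_finite ?set_fsetK ?sumEFin//; exact: finite_fset.
apply: (@le_lt_trans _ _ M%:E); last exact: ltry.
apply: ge_ereal_sup => _ [X [finX _] <-].
by rewrite fsbig_finite// sumEFin lee_fin.
Qed.

Section Scaling.
Context {R : realType} {V : choiceType} (w : V -> R).
Local Notation C := R[i].
Local Notation normc := ComplexField.Normc.normc.

Lemma l2_bounded_scale (f : V -> C) M (c : C) : l2_bounded w f M ->
  exists M', l2_bounded w (fun x => f x / c) M'.
Proof.
move=> fM; exists (normc c^-1 ^+ 2 * M) => A.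
apply: le_trans (ler_wpM2l (sqr_ge0 _) (fM A)); rewrite mulr_sumr ler_sum// => x _.
by rewrite ComplexField.Normc.normcM exprMn mulrAC mulrC.
Qed.

Lemma has_sum_l2_scale (f g : V -> C) s (c d : C) : has_sum (l2_term w f g) s ->
  has_sum (l2_term w (fun x => f x / c) (fun x => g x / d)) (s / c / d^*).
Proof.
move=> fgs; have := @has_sumZ _ _ (c^-1 / d^*) _ _ fgs.
congr has_sum; last by rewrite mulrC mulrA.
apply/funext => x.
rewrite /l2_term rmorphM fmorphV /=; ring.
Qed.
End Scaling.

Theorem corollary15 (R : realType) (q : nat) (V : choiceType) (adj : rel V)
    (omega : set (nat -> V)) (H0 : set V) (a : V -> 'I_q.-1 -> V -> R[i])
    (q_ge2 : (2 <= q)%N)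
    (tree : homogeneous_tree adj q)
    (omega_bd : boundary_point adj omega)
    (H0_horo : is_horocycle adj omega H0)
    (a_basis : forall v : V, Z_orthonormal_basis adj omega H0 v (a v))
    (alpha : R) (alpha_gt1 : 1 < alpha) :
  bergman_orthonormal_basis adj q omega H0 alpha
    (fun (vj : V * 'I_q.-1) (x : V) =>
       g_fun adj q omega H0 vj.1 (a vj.1 vj.2) x /
       (Num.sqrt (b_const q (hindex adj omega H0 vj.1) alpha))%:C%C).
Proof.
set h := hindex adj omega H0; set p := predecessor adj omega H0.
have hp x : h (p x) = h x - 1 by exact: (hindex_predecessor tree omega_bd H0_horo).
have SE v := successorsE tree omega_bd H0_horo v.
have fin v : finite_set [set x | p x = v].
  by rewrite -SE; exact: (finite_successors tree).
have card v : #|` children p v| = q.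
  by rewrite /children -SE (card_successors tree omega_bd H0_horo).
have sumS := @sum_successors R _ _ _ _ _ tree omega_bd H0_horo.
pose w : V -> R := hweight q h alpha.
have w_gt0 x : 0 < w x by exact: hweight_gt0.
have w_ge0 x : 0 <= w x by exact: ltW.
pose b v : R := bconst q h alpha v.
have b_gt0 v : 0 < b v by exact: bconst_gt0.
pose rb v : R[i] := (Num.sqrt (b v))%:C%C.
have rb_neq0 v : rb v != 0.
  by rewrite -(rmorph0 (real_complex R)) (inj_eq (@complexI R)) gt_eqF// sqrtr_gt0.
have rb_real v : (rb v)^* = rb v by exact: conj_realC.
have rb_sqr v : rb v * rb v = (b v)%:C%C.
  by rewrite -rmorphM /= -expr2 sqr_sqrtr// ltW.
pose g v phi := horo_fun q p h v phi : V -> R[i].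
pose e (i : V * 'I_q.-1) x := g i.1 (a i.1 i.2) x / rb i.1.
suff : bergman_orthonormal_basis adj q omega H0 alpha e.
  congr bergman_orthonormal_basis; apply/funext => i; apply/funext => x.
  by rewrite (g_funE tree omega_bd H0_horo).
have aZ v j : \sum_(y <- children p v) a v j y = 0.
  by have [+ _ _] := a_basis v => /(_ j); rewrite /Z_space /= sumS.
have aON v j k : \sum_(y <- children p v) a v j y * (a v k y)^* = (j == k)%:R.
  by have [_ + _] := a_basis v => /(_ j k); rewrite sumS.
have bergmanP (f : V -> R[i]) : bergman adj q omega H0 alpha f <->
    horo_harmonic q p f /\ exists M, l2_bounded w f M.
  rewrite /bergman /= (harmonic_funE tree omega_bd H0_horo) esum_fin_bounded//.
  by move=> x; exact: l2_sqr_ge0.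
have ghar v j : horo_harmonic q p (g v (a v j)) by exact: horo_fun_harmonic.
have gl2 v j : exists M, l2_bounded w (g v (a v j)) M by exact: horo_fun_l2_bounded.
have pairing (f : V -> R[i]) M v j : horo_harmonic q p f -> l2_bounded w f M ->
    has_sum (l2_term w f (g v (a v j)))
      ((b v)%:C%C * \sum_(y <- children p v) branching q p f v y * (a v j y)^*).
  by move=> fh fM; exact: (horo_fun_pairing _ _ _ _ _ fh fM).
have eON i k : has_sum (l2_term w (e i) (e k)) (i == k)%:R.
  case: i k => [u i] [v k]; have [M gM] := gl2 u i.
  have := @has_sum_l2_scale _ _ w _ _ _ (rb u) (rb v) (@pairing _ _ v k (ghar u i) gM).
  congr has_sum; rewrite rb_real (eq_big_seq
    (fun y => (if v == u then a u i y else 0) * (a v k y)^*)); last first.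
    by move=> y; rewrite in_children// => /eqP yv; rewrite branching_horo_fun.
  have [->|vu] := eqVneq v u.
    rewrite aON -rb_sqr [(u, i) == _]xpair_eqE eqxx /=.
    by field; exact: rb_neq0.
  rewrite big1; last by move=> y _; rewrite mul0r.
  by rewrite mulr0 !mul0r [(u, i) == _]xpair_eqE eq_sym (negbTE vu).
split=> [i|i k|f /bergmanP[fh [M fM]]].
- apply/bergmanP; split; last first.
    by have [M gM] := gl2 i.1 i.2; exact: (l2_bounded_scale (rb i.1) gM).
  by move=> x; rewrite -mulr_suml -mulrDl ghar mulrA.
- exact: (has_sum_sum (eON i k)).
pose d v j := \sum_(y <- children p v) branching q p f v y * (a v j y)^*.
pose c (i : V * 'I_q.-1) := rb i.1 * d i.1 i.2.
have coef i : has_sum (l2_term w f (e i)) (c i).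
  have := @has_sum_l2_scale _ _ w _ _ _ 1 (rb i.1) (@pairing _ _ i.1 i.2 fh fM).
  congr has_sum; first by congr (l2_term w _ _); apply/funext => x; rewrite divr1.
  by rewrite /c divr1 rb_real -rb_sqr /d; field; exact: rb_neq0.
have branchE v y : p y = v -> branching q p f v y = \sum_j d v j * a v j y.
  have [_ _ span] := a_basis v.
  have [|r Hr] := span (branching q p f v).
    by rewrite /Z_space /= sumS sum_branching.
  move=> yv; rewrite Hr; last by rewrite SE.
  apply: eq_bigr => j _; congr (_ * _); rewrite /d.
  rewrite (eq_big_seq (fun z => \sum_k r k * (a v k z * (a v j z)^*))); last first.
    move=> z; rewrite in_children// => /eqP zv; rewrite Hr ?SE// mulr_suml.
    by apply: eq_bigr => k _; rewrite mulrA.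
  rewrite exchange_big (bigD1 j)//= -mulr_sumr aON eqxx mulr1 big1 ?addr0// => k kj.
  by rewrite -mulr_sumr aON (negbTE kj) mulr0.
have ceE v j x : c (v, j) * e (v, j) x = d v j * g v (a v j) x.
  by rewrite /c /e /=; field; exact: rb_neq0.
move=> eps eps0.
have [|F HF] := orthonormal_dense w_ge0 eON coef fM _ eps0; last by exists F, c.
move=> X del del0.
have [W HW] := horo_fun_series_approx hp q_ge2 alpha_gt1 X fM del0.
exists [fset ((v, j) : V * 'I_q.-1) | v in W, j in 'I_q.-1]%fset => x /HW.
rewrite big_imfset2 /=; last by move=> [v j] [u k] _ _ /= [-> ->].
congr (ComplexField.Normc.normc _ < _); congr (_ - _); apply: eq_bigr => v _.
rewrite big_enum /=; under eq_bigr do rewrite ceE.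
have [[n xv]|xv] := pselect (exists n, iter n.+1 p x = v); last first.
  have xv' n : iter n.+1 p x <> v by move=> xnv; apply: xv; exists n.
  by rewrite horo_fun_out// big1// => j _; rewrite /g horo_fun_out ?mulr0.
rewrite (horo_fun_in _ hp _ xv) branchE// mulr_sumr; apply: eq_bigr => j _.
by rewrite /g (horo_fun_in _ hp _ xv) mulrCA.
Qed.
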